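(* Let $p\in[1,\infty)$, let $A\in\mathbb{R}^{n\times d}$ have rank $d$, let $b\in\mathbb{R}^n$, let $\mathcal{Z}\subseteq\mathbb{R}^d$ be the constraint set, and let $U\in\mathbb{R}^{n\times d}$ be a basis of the range space of $A$ of the form $U=AF$, where $F\in\mathbb{R}^{d\times d}$. Then the constrained overdetermined $\ell_p$ regression problem $$\min_{x\in\mathcal{Z}}\|Ax-b\|_p$$ is equivalent to $$\min_{y\in\mathcal{Y}}\|Uy-b\|_p^p=\min_{y\in\mathcal{Y}}\mathbb{E}_{\xi\sim P}\left[H(y,\xi)\right],$$ where $\xi$ is a random variable over $\{1,\dots,n\}$ with distribution $P=\{p_i\}_{i=1}^n$, $y$ is the decision variable in $\mathcal{Y}$, and $H(y,\xi)=|U_\xi y-b_\xi|^p/p_\xi$. The constraint set of $y$ is $\mathcal{Y}=\{y\in\mathbb{R}^d : y=F^{-1}x,\ x\in\mathcal{Z}\}$.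
   Context: $U_i$ denotes the $i$-th row of $U$ and $b_i$ the $i$-th entry of $b$. ''A basis of the range space of $A$'' means that the columns of $U$ form a basis of $\mathrm{range}(A)$. ''Overdetermined'' means $n\gg d$. ''Equivalent'' is understood through the change of variables $x=Fy$: $x\in\mathcal{Z}$ is optimal for the first problem if and only if $y=F^{-1}x\in\mathcal{Y}$ is optimal for the second, and the optimal value of the second problem is the $p$-th power of that of the first. *)

(* Defs.v *)
From mathcomp Require Import all_boot all_order all_algebra.
From mathcomp Require Import all_classical all_reals all_analysis.
Set Implicit Arguments.
Unset Strict Implicit.
Unset Printing Implicit Defensive.
Import Order.TTheory GRing.Theory Num.Theory.
Local Open Scope classical_set_scope.
Local Open Scope ring_scope.

Definition lp_norm (R : realType) (n : nat) (p : R) (v : 'cV[R]_n) : R :=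
  (\sum_(i < n) `|v i 0| `^ p) `^ p^-1.

Definition range_space (R : realType) (n d : nat) (A : 'M[R]_(n, d)) :
    {vspace 'cV[R]_n} :=
  limg (linfun (mulmx A : 'cV[R]_d -> 'cV[R]_n)).

Definition columns (R : realType) (n d : nat) (U : 'M[R]_(n, d)) :
    d.-tuple 'cV[R]_n :=
  [tuple col j U | j < d].

(* Objectives take values in \bar R because the library's expectation does. *)
Definition is_optimal (R : realType) (T : Type) (S : set T) (f : T -> \bar R)
    (x : T) : Prop :=
  S x /\ forall x', S x' -> (f x <= f x')%E.

(* The infimum in \bar R: it is the minimum whenever the minimum is attained,
   and +oo when S is empty. *)
Definition optimal_value (R : realType) (T : Type) (S : set T)
    (f : T -> \bar R) : \bar R :=
  ereal_inf [set f x | x in S].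

(* 'I_n carries the discrete sigma-algebra, hence the measurability of every
   preimage.  That mu is nonnegative with total mass 1 follows from Pr being a
   probability. *)
Definition random_index (R : realType) (disp : measure_display)
    (Omega : measurableType disp) (Pr : probability Omega R) (n : nat)
    (xi : Omega -> 'I_n) (mu : 'I_n -> R) : Prop :=
  (forall B : set 'I_n, measurable (xi @^-1` B)) /\
  (forall i : 'I_n, Pr (xi @^-1` [set i]) = (mu i)%:E).

Definition sampled_loss (R : realType) (n d : nat) (p : R) (U : 'M[R]_(n, d))
    (b : 'cV[R]_n) (mu : 'I_n -> R) (y : 'cV[R]_d) (i : 'I_n) : R :=
  `|(row i U *m y) 0 0 - b i 0| `^ p / mu i.

Definition preconditioned_set (R : realType) (d : nat) (F : 'M[R]_d)
    (Z : set 'cV[R]_d) : set 'cV[R]_d :=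
  [set invmx F *m x | x in Z].

(* Main.v *)
(** F is injective because the columns of U = A F are free, so y = F^-1 x is a
    bijection of Z onto Y under which the second objective is the p-th power of
    the first.  As t |-> t ^ p is an order isomorphism of [0, +oo], it preserves
    minimizers and commutes with infima.  Dividing by p_xi cancels the sampling
    weight, so that the expectation is the plain sum of the |U_i y - b_i| ^ p. *)

Require Import Defs.
From mathcomp Require Import all_boot all_order all_algebra.
From mathcomp Require Import all_classical all_reals all_analysis.
From mathcomp Require Import measurable_realfun.
Import Order.TTheory GRing.Theory Num.Theory.
Local Open Scope classical_set_scope.
Local Open Scope ring_scope.

(** [g \o X] is a finite combination of indicators of the fibres of [X], with coefficients [g i].
    Since [g] is nonnegative, integral and sum can be exchanged without an integrability
    argument. *)
Lemma expectation_comp_fin (R : realType) (disp : measure_display)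
    (Omega : measurableType disp) (Pr : probability Omega R) (I : finType)
    (X : Omega -> I) (g : I -> R) :
    (forall i, measurable (X @^-1` [set i])) -> (forall i, 0 <= g i) ->
  ('E_Pr[fun w => g (X w)] =
   \sum_(i : I) (g i)%:E * Pr (X @^-1` [set i]))%E.
Proof.
move=> mX g0; rewrite unlock.
pose t i w : \bar R := ((g i)%:E * (\1_(X @^-1` [set i]) w)%:E)%E.
have mind i : measurable_fun setT
    (EFin \o (\1_(X @^-1` [set i]) : Omega -> R)).
  by apply/measurable_EFinP; exact: measurable_indic.
transitivity (\int[Pr]_w \sum_(i : I) t i w)%E.
  apply: eq_integral => w _.
  (* At [w], only the term of index [X w] is nonzero. *)
  rewrite (bigD1 (X w))//= big1 => [|i /negbTE iX].
    by rewrite /t indicE mem_set// mule1 adde0.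
  by rewrite /t indicE memNset ?mule0// => /= Xw; rewrite Xw eqxx in iX.
rewrite ge0_integral_sum//.
- apply: eq_bigr => i _; rewrite /t ge0_integralZl//.
  + by rewrite integral_indic// setIT.
  + exact: mind.
  + by rewrite lee_fin.
- by move=> i; apply: measurable_funeM; exact: mind.
- by move=> i w _; rewrite /t mule_ge0// lee_fin.
Qed.

(** On [[0, +oo]] the power [p] is increasing with increasing inverse the power [p^-1]; each of the
    two monotonicities gives one inequality. The empty set is covered, both sides being [+oo]. *)
Lemma ereal_inf_poweR (R : realType) (p : R) (S : set \bar R) :
    0 < p -> (forall x, S x -> (0 <= x)%E) ->
  ereal_inf [set (x `^ p)%E | x in S] = (ereal_inf S `^ p)%E.
Proof.
move=> p0 S0; have inf0 : (0 <= ereal_inf S)%E by exact/ereal_infP.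
(* The exponent is left general: both [p] and [p^-1] occur below. *)
have poweR_homo r (x y : \bar R) : 0 <= r -> (0 <= x)%E -> (x <= y)%E ->
    (x `^ r <= y `^ r)%E.
  move=> r0 x0 xy; apply: gt0_ler_poweR => //; rewrite in_itv/= leey andbT//.
  exact: le_trans xy.
have poweRK (x : \bar R) r s : (0 <= x)%E -> r * s = 1 -> ((x `^ r) `^ s)%E = x.
  by move=> x0 rs; rewrite -poweRrM rs poweRe1.
apply/eqP; rewrite eq_le; apply/andP; split; last first.
  apply/ereal_infP => _ [x Sx <-]; apply: (poweR_homo) => //; first exact: ltW.
  exact: ereal_inf_lbound.
set t := ereal_inf _.
have t0 : (0 <= t)%E by apply/ereal_infP => _ [x _ <-]; exact: poweR_ge0.
have pN0 : p != 0 by rewrite gt_eqF.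
(* With [t] written as the [p]-th power of its [p]-th root, it suffices that this root is a lower
   bound of [S]. *)
rewrite -(poweRK t p^-1 p) ?mulVf//.
apply: (poweR_homo); rewrite ?poweR_ge0 ?(ltW p0)//.
apply/ereal_infP => x Sx; rewrite -(poweRK x p p^-1) ?mulfV//; last exact: S0.
apply: (poweR_homo) => //; first by rewrite invr_ge0 ltW.
by apply: ereal_inf_lbound; exists x.
Qed.

Lemma lp_norm_ge0 (R : realType) (n : nat) (p : R) (v : 'cV[R]_n) :
  0 <= lp_norm p v.
Proof. exact: powR_ge0. Qed.

Lemma lp_norm_powR (R : realType) (n : nat) (p : R) (v : 'cV[R]_n) :
  p != 0 -> lp_norm p v `^ p = \sum_(i < n) `|v i 0| `^ p.
Proof.
move=> p0; rewrite /lp_norm -powRrM mulVf// powRr1//.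
by apply: sumr_ge0 => i _; exact: powR_ge0.
Qed.

(** A nonzero vector in the kernel of [F] would give a nontrivial linear relation between the
    columns of [A *m F]. *)
Lemma free_columns_mulmx_unitmx (R : realType) (n d : nat) (A : 'M[R]_(n, d))
    (F : 'M[R]_d) : free (columns (A *m F)) -> F \in unitmx.
Proof.
(* [det0P] yields a left kernel vector, hence the passage to the transpose of [F]. *)
move=> /freeP freeAF; rewrite -unitmx_tr unitmxE unitfE.
apply/negP => /det0P[v v0 vF]; case/eqP: v0.
have Fv : F *m v^T = 0 by rewrite -[F]trmxK -trmx_mul vF trmx0.
apply/rowP => j; rewrite mxE.
apply: (freeAF (v 0)).
transitivity (A *m F *m v^T); last by rewrite -mulmxA Fv mulmx0.
apply/colP => i; rewrite summxE mxE; apply: eq_bigr => k _.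
by rewrite -tnth_nth tnth_mktuple !mxE mulrC.
Qed.

(** The value [i] is drawn with probability [mu i], which cancels the division by [mu i] in the loss
    because it is nonzero. *)
Lemma expectation_sampled_loss (R : realType) (n d : nat) (p : R)
    (U : 'M[R]_(n, d)) (b : 'cV[R]_n) (disp : measure_display)
    (Omega : measurableType disp) (Pr : probability Omega R)
    (xi : Omega -> 'I_n) (mu : 'I_n -> R) (y : 'cV[R]_d) :
    random_index Pr xi mu -> (forall i, 0 < mu i) ->
  ('E_Pr[fun w => sampled_loss p U b mu y (xi w)] =
   (\sum_(i < n) `|(U *m y - b) i 0| `^ p)%:E)%E.
Proof.
move=> [mxi xiE] mu0; rewrite expectation_comp_fin => [|i|i]; last 2 first.
- exact: mxi.
- by rewrite divr_ge0 ?powR_ge0// ltW.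
rewrite -sumEFin; apply: eq_bigr => i _.
rewrite xiE -EFinM /sampled_loss divfK ?gt_eqF//.
by rewrite -row_mul !mxE.
Qed.

Lemma eq_in_optimal_value (R : realType) (T : Type) (S : set T)
    (f g : T -> \bar R) :
  (forall x, S x -> f x = g x) -> optimal_value S f = optimal_value S g.
Proof. by move=> fg; congr ereal_inf; exact: eq_imagel. Qed.

Lemma eq_in_is_optimal (R : realType) (T : Type) (S : set T)
    (f g : T -> \bar R) :
  (forall x, S x -> f x = g x) ->
  forall x, is_optimal S f x <-> is_optimal S g x.
Proof.
move=> fg x; split=> -[Sx opt]; split=> // x' Sx'.
  by rewrite -!fg//; exact: opt.
by rewrite !fg//; exact: opt.
Qed.

Theorem proposition4 (R : realType) (n d : nat) (p : R) (hp : 1 <= p)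
    (A : 'M[R]_(n, d)) (hA : \rank A = d) (b : 'cV[R]_n) (Z : set 'cV[R]_d)
    (U : 'M[R]_(n, d)) (F : 'M[R]_d)
    (hU : basis_of (range_space A) (columns U)) (hUF : U = A *m F)
    (disp : measure_display) (Omega : measurableType disp)
    (Pr : probability Omega R) (xi : Omega -> 'I_n) (mu : 'I_n -> R)
    (hxi : random_index Pr xi mu) (hmu : forall i : 'I_n, 0 < mu i) :
  let Y := preconditioned_set F Z in
  let f := fun x : 'cV[R]_d => (lp_norm p (A *m x - b))%:E in
  let g := fun y : 'cV[R]_d => (lp_norm p (U *m y - b) `^ p)%:E in
  let h := fun y : 'cV[R]_d =>
    ('E_Pr[fun w : Omega => sampled_loss p U b mu y (xi w)])%E in
  [/\ F \in unitmx,
      (forall x y : 'cV[R]_d, x = F *m y ->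
        (is_optimal Z f x <-> is_optimal Y g y)),
      optimal_value Y g = (optimal_value Z f `^ p)%E,
      (forall y : 'cV[R]_d, Y y -> g y = h y) &
      optimal_value Y g = optimal_value Y h /\
      (forall y : 'cV[R]_d, is_optimal Y g y <-> is_optimal Y h y)].
Proof.
move=> Y f g h.
have p0 : 0 < p by exact: lt_le_trans hp.
have unitF : F \in unitmx.
  by apply: (free_columns_mulmx_unitmx _ _ _ A); rewrite -hUF;
    exact: basis_free hU.
have gE x : g (invmx F *m x) = (lp_norm p (A *m x - b) `^ p)%:E.
  by rewrite /g hUF -mulmxA mulKVmx.
have gh y : Y y -> g y = h y.
  by move=> _; rewrite /g /h expectation_sampled_loss// lp_norm_powR// gt_eqF.
(* Strict monotonicity of the power on nonnegative reals makes this an equality of truth values, so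
   it serves both directions of the equivalence of minimizers. *)
have le_gE x x' :
    (g (invmx F *m x) <= g (invmx F *m x'))%E = (f x <= f x')%E.
  rewrite !gE 2!lee_fin (le_mono_in (gt0_ltr_powR p0))// nnegrE;
    exact: lp_norm_ge0.
split; [exact: unitF| | |exact: gh|].
- move=> x y xFy; have -> : y = invmx F *m x by rewrite xFy mulKmx.
  split=> -[Sx opt]; split.
  + by exists x.
  + by move=> _ [x' Zx' <-]; rewrite le_gE; exact: opt.
  (* Injectivity of [invmx F] identifies the preimage in [Z] with [x] itself. *)
  + by case: Sx => x' Zx' /(can_inj (mulKVmx unitF)) <-.
  + by move=> x' Zx'; rewrite -le_gE; apply: opt; exists x'.
(* Once the power is moved inside the infimum, both sides are infima of images of [Z], which agree
   pointwise by [gE]. *)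
- rewrite /optimal_value -ereal_inf_poweR//; last first.
    by move=> _ [x _ <-]; rewrite lee_fin; exact: lp_norm_ge0.
  rewrite /Y /preconditioned_set 2!image_comp.
  apply: (congr1 (@ereal_inf R)).
  by apply: eq_imagel => x _; rewrite [LHS]/comp gE; exact/esym/poweR_EFin.
- by split; [exact: eq_in_optimal_value | exact: eq_in_is_optimal].
Qed.
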